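(* Let $N\ge2$ be an integer, $\lambda=2/N$, and let $0<T<2\lambda$. Then the boundary value problem (BVP) described in the context is not solvable for arbitrary initial and terminal data; that is, there exist $v_0,r_0,v_1,r_1\in H^1(I_L)$ for which there are no $v,r\in H^1(\Omega)$ and control $\boldsymbol{u}$ solving the BVP.
   Context: Setting: dimensionless longitudinal motion of a uniform elastic rod of length $2$ with $N$ control elements of equal length $\lambda=2/N$. Notation: $I_L=(-1,1)$, $I_T=(0,T)$, $\Omega=I_T\times I_L$. Index sets: $J_s=\{1-N,3-N,\dots,N-1\}$, $J_x=\{-N,2-N,\dots,N\}$, $J_c=J_s\cup\{-N-1,N+1\}$. Points and intervals: $x_n=n\lambda/2$ for $n\in J_x$ (so $x_{\pm N}=\pm1$), $I^x_k=(x_{k-1},x_{k+1})$ for $k\in J_s$. Controls: a control is $\boldsymbol{u}=(u_n)_{n\in J_x}\in H^1(I_T;\mathbb{R}^{N+1})$ with $\boldsymbol{u}(0)=0$. It determines uniquely functions $u_k\in H^1(I_T)$, $k\in J_c$, with $u_k(0)=0$, by the linear relations $u_n=u_{n+1}-u_{n-1}$ for $n\in J_x$ and $\sum_{k\in J_c}u_k=0$. (The indices in $J_x$ and $J_c$ have different parity, so the notation is unambiguous.) The force function $f\in L^2(\Omega)$ is $f(t,x)=u_k'(t)$ for $x\in I^x_k$, $k\in J_s$. The BVP: given $v_0,r_0,v_1,r_1\in H^1(I_L)$ and $T$, find $v,r\in H^1(\Omega)$ and a control $\boldsymbol{u}=(u_n)_{n\in J_x}\in H^1(I_T;\mathbb{R}^{N+1})$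 with $\boldsymbol{u}(0)=0$ (which determines the functions $u_k$, $k\in J_c$, and the force $f$ by the stated relations) such that (1) $Q[v,r,\boldsymbol{u}]=0$, where $Q=\int_\Omega q\,\mathrm{d}\Omega$ and $q=\frac14(v_t-r_x)^2+\frac14\big(v_x-(r_t-f)\big)^2$; (2) $v(0,x)=v_0(x)$, $r(0,x)=r_0(x)$, $v(T,x)=v_1(x)$, $r(T,x)=r_1(x)$ for $x\in \bar I_L$; (3) $v(t,\cdot)$ and $r(t,\cdot)$ have no jump at the interior points $x_n$, $n\in J_x\setminus\{-N,N\}$; (4) $r(t,\pm1)=r_0(\pm1)+u_{\pm N\pm1}(t)$ for $t\in I_T$ (signs correlated). Initial, terminal and boundary values are understood in the sense of traces. *)

(* Defs.v *)
From HB Require Import structures.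
From mathcomp Require Import all_boot all_order all_algebra.
From mathcomp Require Import all_classical all_reals all_analysis.

Set Implicit Arguments.
Unset Strict Implicit.
Unset Printing Implicit Defensive.

Import Order.TTheory GRing.Theory Num.Theory.
Import numFieldNormedType.Exports.

Local Open Scope classical_set_scope.
Local Open Scope ring_scope.

(* Functions on a domain D are represented by total functions; only their
   values almost everywhere in D matter. Measurability refers to the Borel
   sigma-algebra, which loses no class of Lebesgue-measurable functions. *)

Section L2.
Context {d : measure_display} {X : measurableType d} {R : realType}.
Variable mu : {measure set X -> \bar R}.

Definition L2 (D : set X) (u : X -> R) : Prop :=
  measurable_fun D u /\ mu.-integrable D (fun z => (u z ^+ 2)%:E).

Definition L2_cvg (D : set X) (phi : nat -> X -> R) (u : X -> R) : Prop :=
  (\int[mu]_(z in D) ((phi n z - u z) ^+ 2)%:E)%E @[n --> \oo] --> 0%E.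

End L2.

Section smooth.
Context {R : realType} {V : normedModType R}.

(* C^k through iterated directional derivatives; in finite dimension this is
   the usual notion. *)
Fixpoint Ck (k : nat) (phi : V -> R) : Prop :=
  continuous phi /\
  if k is k'.+1 then
    forall e : V, (forall z, derivable phi z e) /\ Ck k' (fun z => 'D_e phi z)
  else True.

Definition smooth (phi : V -> R) : Prop := forall k, Ck k phi.

Definition test_function (D : set V) (phi : V -> R) : Prop :=
  smooth phi /\
  exists K : set V, [/\ compact K, K `<=` D & forall z, ~ K z -> phi z = 0].

End smooth.

Section Sobolev1.
Context {R : realType}.
Local Notation mu := (@lebesgue_measure R).

Definition weak_deriv1 (I : set R) (u w : R -> R) : Prop :=
  L2 mu I w /\
  forall phi : R -> R, test_function I phi ->
    \int[mu]_(t in I) (u t * derive1 phi t) = - \int[mu]_(t in I) (w t * phi t).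

Definition H1 (I : set R) (u : R -> R) : Prop :=
  L2 mu I u /\ exists w, weak_deriv1 I u w.

(* The weak derivative, unique almost everywhere in I. *)
Definition wderiv1 (I : set R) (u : R -> R) : R -> R :=
  xget (fun=> 0) [set w | weak_deriv1 I u w].

Definition H1_approx1 (I : set R) (phi : nat -> R -> R) (u : R -> R) : Prop :=
  [/\ forall n, smooth (phi n),
      L2_cvg mu I phi u
    & L2_cvg mu I (fun n => derive1 (phi n)) (wderiv1 I u)].

(* c is the trace of u at s, an endpoint of I: the trace operator is the
   continuous extension to H^1 of the evaluation of smooth functions. *)
Definition trace1 (I : set R) (s : R) (u : R -> R) (c : R) : Prop :=
  exists phi : nat -> R -> R, H1_approx1 I phi u /\ phi n s @[n --> \oo] --> c.

End Sobolev1.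

Section Sobolev2.
Context {R : realType}.
Local Notation mu := (@lebesgue_measure R).
Local Notation mu2 := (@lebesgue_measure R \x @lebesgue_measure R)%E.

(* Points are pairs (t, x). *)
Definition e_t : R * R := (1, 0).
Definition e_x : R * R := (0, 1).

Definition weak_deriv (D : set (R * R)) (e : R * R) (u w : R * R -> R) : Prop :=
  L2 mu2 D w /\
  forall phi : R * R -> R, test_function D phi ->
    \int[mu2]_(z in D) (u z * 'D_e phi z) = - \int[mu2]_(z in D) (w z * phi z).

Definition H1_2 (D : set (R * R)) (u : R * R -> R) : Prop :=
  [/\ L2 mu2 D u, exists w, weak_deriv D e_t u w
    & exists w, weak_deriv D e_x u w].

Definition wderiv (D : set (R * R)) (e : R * R) (u : R * R -> R) : R * R -> R :=
  xget (fun=> 0) [set w | weak_deriv D e u w].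

Definition H1_approx (D : set (R * R)) (phi : nat -> R * R -> R)
    (u : R * R -> R) : Prop :=
  [/\ forall n, smooth (phi n),
      L2_cvg mu2 D phi u,
      L2_cvg mu2 D (fun n z => 'D_e_t (phi n) z) (wderiv D e_t u)
    & L2_cvg mu2 D (fun n z => 'D_e_x (phi n) z) (wderiv D e_x u)].

(* g is the trace of u, taken from inside the rectangle A `*` B, on the side
   {s} `*` B (trace_t) or A `*` {s} (trace_x); equality of traces is equality
   in L^2 of the side. *)
Definition trace_t (A B : set R) (s : R) (u : R * R -> R) (g : R -> R) : Prop :=
  L2 mu B g /\
  exists phi : nat -> R * R -> R,
    H1_approx (A `*` B) phi u /\ L2_cvg mu B (fun n x => phi n (s, x)) g.

Definition trace_x (A B : set R) (s : R) (u : R * R -> R) (g : R -> R) : Prop :=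
  L2 mu A g /\
  exists phi : nat -> R * R -> R,
    H1_approx (A `*` B) phi u /\ L2_cvg mu A (fun n t => phi n (t, s)) g.

End Sobolev2.

Section rod.
Context {R : realType}.
Local Notation mu := (@lebesgue_measure R).
Local Notation mu2 := (@lebesgue_measure R \x @lebesgue_measure R)%E.
Variable N : nat.

Definition Js : seq int := [seq 1 - N%:Z + 2 * i%:Z | i <- iota 0 N].
Definition Jx : seq int := [seq - N%:Z + 2 * i%:Z | i <- iota 0 N.+1].
Definition Jc : seq int := [:: - N%:Z - 1, N%:Z + 1 & Js].

Definition lambda : R := 2 / N%:R.
Definition node (n : int) : R := n%:~R * lambda / 2.
Definition cell (k : int) : set R := `]node (k - 1), node (k + 1)[.

Definition I_L : set R := `]-1, 1[.

Variable T : R.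
Definition I_T : set R := `]0, T[.
Definition Omega : set (R * R) := I_T `*` I_L.

(* A single family u indexed by the integers carries both the control (u_n),
   n in Jx, and the functions (u_k), k in Jc, which it determines: Jx and Jc
   are disjoint by parity. Values at other indices are irrelevant. *)
Definition is_control (u : int -> R -> R) : Prop :=
  [/\ forall n, n \in Jx -> H1 I_T (u n) /\ trace1 I_T 0 (u n) 0,
      forall k, k \in Jc -> H1 I_T (u k) /\ trace1 I_T 0 (u k) 0,
      forall n, n \in Jx ->
        {ae mu, forall t, I_T t -> u n t = u (n + 1) t - u (n - 1) t}
    & {ae mu, forall t, I_T t -> \sum_(k <- Jc) u k t = 0}].

Definition force (u : int -> R -> R) (z : R * R) : R :=
  \sum_(k <- Js) wderiv1 I_T (u k) z.1 * \1_(cell k) z.2.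

Definition q (v r : R * R -> R) (u : int -> R -> R) (z : R * R) : R :=
  4^-1 * (wderiv Omega e_t v z - wderiv Omega e_x r z) ^+ 2 +
  4^-1 * (wderiv Omega e_x v z - (wderiv Omega e_t r z - force u z)) ^+ 2.

Definition Q (v r : R * R -> R) (u : int -> R -> R) : \bar R :=
  (\int[mu2]_(z in Omega) (q v r u z)%:E)%E.

(* The one-sided traces on I_T `*` {node n} from the two adjacent cells agree. *)
Definition no_jump (w : R * R -> R) (n : int) : Prop :=
  exists g : R -> R, trace_x I_T (cell (n - 1)) (node n) w g /\
                     trace_x I_T (cell (n + 1)) (node n) w g.

Definition boundary_condition (r : R * R -> R) (r0 : R -> R) (s : R)
    (us : R -> R) : Prop :=
  exists c : R, trace1 I_L s r0 c /\
                trace_x I_T I_L s r (fun t => c + us t).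

Definition solves_BVP (v0 r0 v1 r1 : R -> R)
    (v r : R * R -> R) (u : int -> R -> R) : Prop :=
  [/\ [/\ H1_2 Omega v, H1_2 Omega r & is_control u],
      Q v r u = 0%E,
      [/\ trace_t I_T I_L 0 v v0, trace_t I_T I_L 0 r r0,
          trace_t I_T I_L T v v1 & trace_t I_T I_L T r r1],
      forall n, n \in Jx -> n != - N%:Z -> n != N%:Z ->
        no_jump v n /\ no_jump r n
    & boundary_condition r r0 (-1) (u (- N%:Z - 1)) /\
      boundary_condition r r0 1 (u (N%:Z + 1))].

End rod.

(* Main.v *)
Require Import Defs.
From HB Require Import structures.
From mathcomp Require Import all_boot all_order all_algebra.
From mathcomp Require Import all_classical all_reals all_analysis.
From mathcomp Require Import measurable_realfun.
From mathcomp Require Import ring lra.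

(* The functional (v, r) |-> int (v p + r s) dx is conserved by every solution,
   whatever the control, for a suitable solution (p, s) of the adjoint system
   p_t = s_x, s_t = p_x. For the force and the boundary values to drop out, p
   and s must vanish at x = 1 and x = -1 and s must have mean zero over every
   cell. Such a state consists of two pulses crossing at the node 1 - lambda,
   p = b'(t + z) - b'(t - z) and s = - b'(t + z) - b'(t - z) with
   z = 1 - lambda - x: then s = d/dx (b(t + z) - b(t - z)), and the function
   differentiated vanishes at all nodes as soon as b is supported in
   [T - lambda, lambda], an interval which is nontrivial exactly when
   T < 2 lambda. With zero initial data the conserved quantity is zero, whereas
   the terminal data v1 = x, r1 = 0 give
   int x p(T, x) dx = int (b(T + z) + b(T - z)) dx > 0. *)

Set Implicit Arguments.
Unset Strict Implicit.
Unset Printing Implicit Defensive.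

Import Order.TTheory GRing.Theory Num.Theory.
Import numFieldNormedType.Exports.

Local Open Scope classical_set_scope.
Local Open Scope ring_scope.

(** * Measurability on the plane *)

Section plane.
Context {R : realType}.

(** The plane carries the product sigma-algebra, so an open set is exhibited as a countable union of
    boxes: those with rational corners that fit inside [U]. Making [C q] empty for the other boxes
    lets the union run over a whole countable type. *)
Lemma open_plane_measurable (U : set (R * R)) : open U -> measurable U.
Proof.
move=> oU.
pose B (q : rat * rat * (rat * rat)) : set (R * R) :=
  `]ratr q.1.1, ratr q.1.2[ `*` `]ratr q.2.1, ratr q.2.2[.
pose C q := if `[< B q `<=` U >] then B q else set0.
have -> : U = \bigcup_q C q.
  apply/seteqP; split => [[x y] Uxy|z [q _]]; last first.
    by rewrite /C; case: asboolP => // BU /BU.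
  have /nbhs_ballP[e /= e0 eU] : nbhs (x, y) U by exact: open_nbhs_nbhs.
  have h (w : R) : exists q : rat * rat,
      (w \in `]ratr q.1, ratr q.2[) /\ `]ratr q.1, ratr q.2[ `<=` ball w e.
    have [q1 /itvP q1w] := @rat_in_itvoo R (w - e) w ltac:(lra).
    have [q2 /itvP q2w] := @rat_in_itvoo R w (w + e) ltac:(lra).
    exists (q1, q2); rewrite in_itv/= !(q1w, q2w); split => // v.
    rewrite ball_itv/= !in_itv/= => /andP[a b]; apply/andP; split.
      by apply: lt_trans a; rewrite q1w.
    by apply: (lt_trans b); rewrite q2w.
  have [q1 [xq1 bq1]] := h x; have [q2 [yq2 bq2]] := h y.
  exists (q1, q2) => //; rewrite /C; case: asboolP => [_|]; first by split.
  by case=> -[v w] [/= /bq1 vx /bq2 wy]; apply: eU; split.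
apply: countable_bigcupT_measurable => // q; rewrite /C.
by case: asboolP => // _; exact: measurableX.
Qed.

Lemma continuous_plane_measurable (f : R * R -> R) (D : set (R * R)) :
  measurable D -> continuous f -> measurable_fun D f.
Proof.
move=> mD cf; apply: measurable_funTS.
apply: (measurability _ (RGenOInfty.measurableE R)) => _ [_ [a ->] <-].
rewrite setTI; apply: open_plane_measurable.
by apply: open_comp => //; exact: interval_open.
Qed.

End plane.

(** * Limits of integrals against bounded multipliers *)

Section multiplier.
Context {d : measure_display} {X : measurableType d} {R : realType}.
Variable mu : {measure set X -> \bar R}.
Variable D : set X.
Hypotheses (mD : measurable D) (fD : (mu D < +oo)%E).

(** This class covers both the continuous weights on a bounded rectangle and the indicators of
    cells; on a set of finite measure such a factor turns [L2] functions into integrable ones. *)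
Definition multiplier (eta : X -> R) : Prop :=
  measurable_fun D eta /\ exists M : R, forall z, D z -> `|eta z| <= M.

Lemma multiplier_integrable (eta : X -> R) :
  multiplier eta -> mu.-integrable D (EFin \o eta).
Proof.
move=> [meta [M etaM]]; apply: measurable_bounded_integrable => //.
exists M; split; first exact: num_real.
by move=> y My z Dz /=; rewrite (le_trans (etaM _ Dz))// ltW.
Qed.

Lemma indic_multiplier (A : set X) : measurable A -> multiplier (\1_A : X -> R).
Proof.
move=> mA; split; first exact: measurable_indic.
by exists 1 => z _; rewrite indicE; case: (_ \in _); rewrite ?normr1 ?normr0.
Qed.

Lemma integrable_EFinZl (r : R) (f : X -> R) : mu.-integrable D (EFin \o f) ->
  mu.-integrable D (EFin \o (fun z => r * f z)).
Proof.
by move=> ?; rewrite (_ : _ \o _ = fun z => r%:E * (f z)%:E)%E//; exact: integrableZl.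
Qed.

Lemma ae_eq_Rintegral (f g : X -> R) :
  mu.-integrable D (EFin \o f) -> mu.-integrable D (EFin \o g) ->
  {ae mu, forall z, D z -> f z = g z} ->
  \int[mu]_(z in D) f z = \int[mu]_(z in D) g z.
Proof.
move=> intf intg fg; congr fine.
apply: (ae_eq_integral (EFin \o g) (EFin \o f) mD (measurable_int mu intf) (measurable_int mu intg)).
by apply: filterS fg => z fg /fg /= ->.
Qed.

Lemma integrable_EFinD (f g : X -> R) : mu.-integrable D (EFin \o f) ->
  mu.-integrable D (EFin \o g) -> mu.-integrable D (EFin \o (fun z => f z + g z)).
Proof.
by move=> ? ?; rewrite (_ : _ \o _ = fun z => (f z)%:E + (g z)%:E)%E//; exact: integrableD.
Qed.

Lemma multiplierM (f g : X -> R) :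
  multiplier f -> multiplier g -> multiplier (fun z => f z * g z).
Proof.
move=> [mf [M fM]] [mg [K gK]]; split; first exact: measurable_funM.
by exists (M * K) => z Dz; rewrite normrM ler_pM// ?fM ?gK.
Qed.

Lemma multiplier_L2 (f : X -> R) : multiplier f -> L2 mu D f.
Proof.
move=> mf; split; first by case: mf.
rewrite (_ : (fun z => _) = EFin \o (fun z => f z * f z)); last first.
  by apply/funext => z /=; rewrite expr2.
by apply: multiplier_integrable; exact: multiplierM.
Qed.

(** Since [|u| <= 1 + u^2], the product is dominated by [M * (1 + u^2)], which is integrable because
    [D] has finite measure. *)
Lemma L2_mul_integrable (u eta : X -> R) : L2 mu D u -> multiplier eta ->
  mu.-integrable D (EFin \o (fun z => u z * eta z)).
Proof.
move=> [mu_ iu] [meta [M etaM]].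
apply: (@le_integrable _ _ _ mu D mD _ (EFin \o (fun z => M * (1 + u z ^+ 2)))).
- by apply/measurable_EFinP; exact: measurable_funM.
- move=> z Dz /=; rewrite lee_fin normrM.
  have u2 : 0 <= u z ^+ 2 by exact: sqr_ge0.
  have M0 : 0 <= M by rewrite (le_trans _ (etaM z Dz)).
  have h : `|u z| <= 1 + u z ^+ 2.
    by rewrite -(real_normK (num_real (u z))); have := normr_ge0 (u z); nra.
  rewrite [leRHS]ger0_norm ?mulr_ge0// ?addr_ge0// mulrC.
  by rewrite ler_pM// etaM.
- apply: integrable_EFinZl; apply: integrable_EFinD => //.
  by apply: (@multiplier_integrable (cst 1)); split => //; exists 1 => z _; rewrite normr1.
Qed.

Lemma L2B (u v : X -> R) : L2 mu D u -> L2 mu D v ->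
  L2 mu D (fun z => u z - v z).
Proof.
move=> [mu_ iu] [mv iv]; split; first exact: measurable_funB.
apply: (@le_integrable _ _ _ mu D mD _
    (EFin \o (fun z => 2 * (u z ^+ 2 + v z ^+ 2)))).
- apply/measurable_EFinP; apply: measurable_funX; exact: measurable_funB.
- move=> z Dz /=; rewrite lee_fin !ger0_norm ?sqr_ge0//.
    have := sqr_ge0 (u z + v z); nra.
  by rewrite mulr_ge0// addr_ge0// sqr_ge0.
- by apply: integrable_EFinZl; exact: integrable_EFinD.
Qed.

(** The [L1] distance is controlled by the squared [L2] distance through [|w| <= k + w^2 / k], valid
    for every [k > 0]: the first term is small by the choice of [k], the second tends to zero once
    [k] is fixed. *)
Lemma cvg_Rintegral_mul (phi : nat -> X -> R) (u eta : X -> R) :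
  (forall n, L2 mu D (phi n)) -> L2 mu D u -> L2_cvg mu D phi u ->
  multiplier eta ->
  \int[mu]_(z in D) (phi n z * eta z) @[n --> \oo] -->
  \int[mu]_(z in D) (u z * eta z).
Proof.
move=> Lphi Lu phiu meta.
have [_ [M0 etaM0]] := meta.
(* Enlarged to be at least 1, so that dividing by the bound is legitimate even when [eta]
   vanishes. *)
pose M : R := `|M0| + 1.
have M1 : 1 <= M by rewrite lerDr.
have etaM z : D z -> `|eta z| <= M.
  by move=> /etaM0 h; rewrite (le_trans h)// (le_trans (ler_norm _))// lerDl.
pose m : R := fine (mu D).
have m0 : 0 <= m by rewrite fine_ge0.
pose J n := \int[mu]_(z in D) ((phi n z - u z) ^+ 2).
have Jcvg : J n @[n --> \oo] --> 0 by apply: fine_cvg.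
apply/cvgrPdist_lt => e e0.
(* Chosen so that the constant [M * k] integrates over [D] to less than [e / 2]; [m + 1] stands in
   the denominator because [m] may be zero. *)
pose k : R := e / (2 * M * (m + 1)).
have k0 : 0 < k by rewrite divr_gt0// !mulr_gt0//; lra.
have Mm : M * (k * m) < e / 2.
  rewrite /k mulrA mulrAC.
  rewrite (_ : M * m * _ = e / 2 * (m / (m + 1))); last first.
    by field; rewrite !lt0r_neq0//; lra.
  rewrite gtr_pMr; last lra.
  by rewrite ltr_pdivrMr; lra.
(* The threshold for [J n] below which [M * (k^-1 * J n)] is less than [e / 2]. *)
have JM0 : 0 < k * e / (2 * M) by rewrite divr_gt0 ?(mulr_gt0 k0)// mulr_gt0//; lra.
near=> n.
have Jn : J n < k * e / (2 * M).
  near: n; apply: (cvgr_lt 0) => //.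
have iu := L2_mul_integrable Lu meta.
have iphi := L2_mul_integrable (Lphi n) meta.
have Lw := L2B (Lphi n) Lu.
have iw2 := Lw.2.
have iw := L2_mul_integrable Lw meta.
rewrite distrC -RintegralB//.
under eq_Rintegral do rewrite -mulrBl.
apply: (le_lt_trans (le_normr_Rintegral mD iw)).
have ik : mu.-integrable D (EFin \o cst k).
  by apply: multiplier_integrable; split => //; exists `|k|.
have ir : mu.-integrable D
    (EFin \o (fun z => M * (k + k^-1 * (phi n z - u z) ^+ 2))).
  by apply: integrable_EFinZl; apply: integrable_EFinD => //; exact: integrable_EFinZl.
apply: (@le_lt_trans _ _
    (\int[mu]_(z in D) (M * (k + k^-1 * (phi n z - u z) ^+ 2)))).
  apply: le_Rintegral => //.
    rewrite (_ : _ \o _ = abse \o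
      (EFin \o (fun z => (phi n z - u z) * eta z)))//.
    exact: integrable_abse.
  move=> z Dz; rewrite normrM mulrC ler_pM ?etaM//.
  rewrite -(real_normK (num_real (phi n z - u z))); set w : R := `|_|.
  rewrite -(ler_pM2l k0) (_ : k * (_ + _) = k * k + w ^+ 2); last first.
    by field; rewrite lt0r_neq0.
  have := sqr_ge0 (k - w); have w0 : 0 <= w := normr_ge0 _; nra.
rewrite RintegralZl//; last first.
  by apply: integrable_EFinD => //; exact: integrable_EFinZl.
rewrite RintegralD//; last exact: integrable_EFinZl.
rewrite Rintegral_cst// RintegralZl// -/m -/(J n) mulrDr.
have : M * (k^-1 * J n) < e / 2.
  rewrite mulrA -ltr_pdivlMl; last by rewrite divr_gt0//; lra.
  by apply: (lt_le_trans Jn); rewrite invf_div le_eqVlt; apply/orP; left; apply/eqP; field; rewrite !lt0r_neq0//; lra.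
by lra.
Unshelve. all: by end_near. Qed.

End multiplier.

(** * Fundamental theorem of calculus and iterated integrals on a rectangle *)

Section calculus.
Context {R : realType}.
Local Notation mu := (@lebesgue_measure R).
Local Notation mu2 := (@lebesgue_measure R \x @lebesgue_measure R)%E.

Lemma integral_derive_itvoo (F f : R -> R) (a b : R) : a <= b ->
  continuous f -> (forall x : R, is_derive x (1 : R) F (f x)) ->
  (\int[mu]_(x in `]a, b[) (f x)%:E)%E = (F b - F a)%:E.
Proof.
rewrite le_eqVlt => /predU1P[<-|ab] cf dF.
  by rewrite set_itvoo0 integral_set0 subrr.
have mf : measurable_fun setT (EFin \o f).
  by apply/measurable_EFinP; exact: continuous_measurable_fun.
have cF : continuous F.
  by move=> x; apply/differentiable_continuous/derivable1_diffP; have [] := dF x.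
rewrite integral_itv_bndo_bndc; last exact: measurable_funTS.
rewrite integral_itv_obnd_cbnd; last exact: measurable_funTS.
rewrite (@continuous_FTC2 _ _ F)//.
- by apply: continuous_subspaceT.
- split.
  + by move=> x _; have [] := dF x.
  + exact/cvg_at_right_filter/cF.
  + exact/cvg_at_left_filter/cF.
- by move=> x _; rewrite derive1E; have [_] := dF x.
Qed.

Lemma continuous_itv_multiplier (f : R -> R) (a b : R) :
  continuous f -> multiplier `]a, b[ f.
Proof.
move=> cf; split.
  exact: (measurable_funTS (continuous_measurable_fun cf)).
have /compact_bounded[M [_ Mf]] : compact (f @` `[a, b]).
  by apply: continuous_compact; [exact: continuous_subspaceT|exact: segment_compact].
exists (M + 1) => z /= zab; apply: (Mf (M + 1)); first by rewrite ltrDl.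
by exists z => //=; exact: subset_itv_oo_cc.
Qed.

Lemma mu_itv_lty (a b : R) : (mu `]a, b[ < +oo)%E.
Proof. by rewrite lebesgue_measure_itv/=; case: ifPn => //; rewrite -EFinD ltry. Qed.

Lemma mu2_rect_lty (a b c d : R) : (mu2 (`]a, b[ `*` `]c, d[) < +oo)%E.
Proof. by rewrite product_measure1E//= lte_mul_pinfty ?ge0_fin_numE ?mu_itv_lty. Qed.

Lemma continuous_rect_multiplier (f : R * R -> R) (a b c d : R) :
  continuous f -> multiplier (`]a, b[ `*` `]c, d[) f.
Proof.
move=> cf; split; first by apply: continuous_plane_measurable => //; exact: measurableX.
have /compact_bounded[M [_ Mf]] : compact (f @` (`[a, b] `*` `[c, d])).
  apply: continuous_compact; first exact: continuous_subspaceT.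
  by apply: compact_setX; exact: segment_compact.
exists (M + 1) => z /= [z1 z2]; apply: (Mf (M + 1)); first by rewrite ltrDl.
by exists z => //=; split; exact: subset_itv_oo_cc.
Qed.

Section fubini.
Variables (I J : set R) (g : R * R -> R) (h : R -> R).
Hypotheses (mI : measurable I) (mJ : measurable J).
Hypothesis ig : mu2.-integrable (I `*` J) (EFin \o g).

Let igD : mu2.-integrable setT ((EFin \o g) \_ (I `*` J)).
Proof. by apply/integrable_restrict => //; rewrite ?setTI//; exact: measurableX. Qed.

(** Fubini is applied on the whole plane to the extension by zero; slices outside [J] then vanish,
    which is why only slices through [J] have to be computed. *)
Lemma Rintegral_iterated_tx :
  (forall x, J x -> (\int[mu]_(t in I) (g (t, x))%:E)%E = (h x)%:E) ->
  \int[mu2]_(z in I `*` J) g z = \int[mu]_(x in J) h x.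
Proof.
move=> gh; congr fine; rewrite integral_mkcond -integral21_prod_meas1//.
rewrite [RHS]integral_mkcond; apply: eq_integral => x _.
rewrite /fubini_G /patch; case: ifPn => [/set_mem Jx|/negP Jx].
  rewrite -gh// [RHS]integral_mkcond; apply: eq_integral => t _.
  rewrite /patch; congr (if _ then _ else _).
  by rewrite in_setX/= (mem_set Jx) andbT.
rewrite integral0_eq// => t _.
by rewrite in_setX/= (negbTE (introN idP Jx)) andbF.
Qed.

Lemma Rintegral_iterated_xt :
  (forall t, I t -> (\int[mu]_(x in J) (g (t, x))%:E)%E = (h t)%:E) ->
  \int[mu2]_(z in I `*` J) g z = \int[mu]_(t in I) h t.
Proof.
move=> gh; congr fine; rewrite integral_mkcond -integral12_prod_meas1//.
rewrite [RHS]integral_mkcond; apply: eq_integral => t _.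
rewrite /fubini_F /patch; case: ifPn => [/set_mem It|/negP It].
  rewrite -gh// [RHS]integral_mkcond; apply: eq_integral => x _.
  rewrite /patch; congr (if _ then _ else _).
  by rewrite in_setX/= (mem_set It).
rewrite integral0_eq// => x _.
by rewrite in_setX/= (negbTE (introN idP It)).
Qed.

End fubini.

End calculus.

(** * Integration by parts up to the traces *)

Section C1.
Context {R : realType}.
Local Notation mu := (@lebesgue_measure R).
Local Notation mu2 := (@lebesgue_measure R \x @lebesgue_measure R)%E.
Implicit Types f g : R * R -> R.

(** The partial derivatives are arguments rather than existential witnesses, so that the adjoint
    system [p_t = s_x], [s_t = p_x] can be written as the pair [C1 p a b], [C1 s b a]. *)
Definition C1 f ft fx : Prop :=
  [/\ continuous f, continuous ft, continuous fx,
      forall t x : R, is_derive t (1 : R) (fun t => f (t, x)) (ft (t, x))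
    & forall t x : R, is_derive x (1 : R) (fun x => f (t, x)) (fx (t, x))].

Lemma is_derive_slice_t (f : R * R -> R) (t x : R) : derivable f (t, x) e_t ->
  is_derive t (1 : R) (fun t => f (t, x)) ('D_e_t f (t, x)).
Proof.
move=> df.
have E : (fun h : R => h^-1 *: ((f \o shift (t, x)) (h *: e_t) - f (t, x))) =
    (fun h : R => h^-1 *: (((fun t => f (t, x)) \o shift t) (h *: (1 : R)) - f (t, x))).
  apply/funext => h /=; congr (_ *: (f _ - _)).
  by congr pair => /=; rewrite scaler0 add0r.
by split; [rewrite /derivable -E|rewrite /derive -E].
Qed.

Lemma is_derive_slice_x (f : R * R -> R) (t x : R) : derivable f (t, x) e_x ->
  is_derive x (1 : R) (fun x => f (t, x)) ('D_e_x f (t, x)).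
Proof.
move=> df.
have E : (fun h : R => h^-1 *: ((f \o shift (t, x)) (h *: e_x) - f (t, x))) =
    (fun h : R => h^-1 *: (((fun x => f (t, x)) \o shift x) (h *: (1 : R)) - f (t, x))).
  apply/funext => h /=; congr (_ *: (f _ - _)).
  by congr pair => /=; rewrite scaler0 add0r.
by split; [rewrite /derivable -E|rewrite /derive -E].
Qed.

Lemma smooth_C1 f : smooth f -> C1 f ('D_e_t f) ('D_e_x f).
Proof.
move=> /(_ 1%N)[cf df]; split => //.
- by have [_ []] := df e_t.
- by have [_ []] := df e_x.
- by move=> t x; apply: is_derive_slice_t; have [] := df e_t.
- by move=> t x; apply: is_derive_slice_x; have [] := df e_x.
Qed.

Lemma C1M f ft fx g gt gx : C1 f ft fx -> C1 g gt gx ->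
  C1 (fun z => f z * g z) (fun z => f z * gt z + ft z * g z)
     (fun z => f z * gx z + fx z * g z).
Proof.
move=> [cf cft cfx dft dfx] [cg cgt cgx dgt dgx]; split.
- by move=> z; apply: cvgM; [exact: cf|exact: cg].
- move=> z; apply: cvgD; apply: cvgM;
  by [exact: cf|exact: cg|exact: cft|exact: cgt].
- move=> z; apply: cvgD; apply: cvgM;
  by [exact: cf|exact: cg|exact: cfx|exact: cgx].
- move=> t x; apply: is_derive_eq (is_deriveM (dft t x) (dgt t x)) _.
  by rewrite /GRing.scale/= [ft _ * _]mulrC.
- move=> t x; apply: is_derive_eq (is_deriveM (dfx t x) (dgx t x)) _.
  by rewrite /GRing.scale/= [fx _ * _]mulrC.
Qed.

Section rectangle.
Variables (a b c d : R).
Hypotheses (ab : a <= b) (cd : c <= d).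
Let I := `]a, b[%classic.
Let J := `]c, d[%classic.
Let D := I `*` J.

Let mI : measurable I. Proof. exact: measurable_itv. Qed.
Let mJ : measurable J. Proof. exact: measurable_itv. Qed.
Let mD : measurable D. Proof. exact: measurableX. Qed.
Let fD : (mu2 D < +oo)%E. Proof. exact: mu2_rect_lty. Qed.

Lemma slice_t_continuous f (x : R) : continuous f -> continuous (fun t => f (t, x)).
Proof.
move=> cf t; apply: (@continuous_comp _ _ _ (fun t => (t, x)) f); last exact: cf.
by apply: (@cvg_pair _ _ _ (nbhs t) (nbhs t) (nbhs x)) => //; exact: cvg_cst.
Qed.

Lemma slice_x_continuous f (t : R) : continuous f -> continuous (fun x => f (t, x)).
Proof.
move=> cf x; apply: (@continuous_comp _ _ _ (fun x => (t, x)) f); last exact: cf.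
by apply: (@cvg_pair _ _ _ (nbhs x) (nbhs t) (nbhs x)) => //; exact: cvg_cst.
Qed.

Lemma Rintegral_dt f ft fx : C1 f ft fx ->
  \int[mu2]_(z in D) ft z = \int[mu]_(x in J) (f (b, x) - f (a, x)).
Proof.
move=> [cf cft _ df _]; apply: Rintegral_iterated_tx => //.
  by apply: multiplier_integrable => //; exact: continuous_rect_multiplier.
by move=> x Jx; apply: integral_derive_itvoo => //; exact: slice_t_continuous.
Qed.

Lemma Rintegral_dx f ft fx : C1 f ft fx ->
  \int[mu2]_(z in D) fx z = \int[mu]_(t in I) (f (t, d) - f (t, c)).
Proof.
move=> [cf _ cfx _ df]; apply: Rintegral_iterated_xt => //.
  by apply: multiplier_integrable => //; exact: continuous_rect_multiplier.
by move=> x Jx; apply: integral_derive_itvoo => //; exact: slice_x_continuous.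
Qed.

(** As soon as some weak derivative exists, [xget] returns a genuine one instead of its default 0,
    and square integrability is part of being a weak derivative. *)
Lemma wderiv_L2 (e : R * R) (u : R * R -> R) :
  (exists w, weak_deriv D e u w) -> L2 mu2 D (wderiv D e u).
Proof.
by move=> [w uw]; have [] := xgetPex (fun=> 0) (ex_intro [set w | weak_deriv D e u w] w uw).
Qed.

Let continuous_L2 f : continuous f -> L2 mu2 D f.
Proof. by move=> cf; apply: multiplier_L2 => //; exact: continuous_rect_multiplier. Qed.

Let L2_mul u eta : L2 mu2 D u -> continuous eta ->
  mu2.-integrable D (EFin \o (fun z => u z * eta z)).
Proof. by move=> Lu ceta; apply: L2_mul_integrable => //; exact: continuous_rect_multiplier. Qed.

Let cvg_mul (phi : nat -> R * R -> R) (u eta : R * R -> R) :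
  (forall n, L2 mu2 D (phi n)) -> L2 mu2 D u -> L2_cvg mu2 D phi u ->
  continuous eta ->
  \int[mu2]_(z in D) (phi n z * eta z) @[n --> \oo] -->
  \int[mu2]_(z in D) (u z * eta z).
Proof.
move=> Lphi Lu phiu ceta; apply: cvg_Rintegral_mul => //.
exact: continuous_rect_multiplier.
Qed.

(* [kappa] is the boundary value of [eta] with the sign of the outer normal:
   [eta] is assumed to vanish on the side opposite to the one carrying the
   trace, since the approximating sequences of two traces may differ. *)
Lemma trace_t_by_parts (s : R) (u eta eta_t eta_x : R * R -> R) (g kappa : R -> R) :
  H1_2 D u -> trace_t I J s u g -> C1 eta eta_t eta_x -> continuous kappa ->
  (forall f x, f (b, x) * eta (b, x) - f (a, x) * eta (a, x) = f (s, x) * kappa x) ->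
  \int[mu2]_(z in D) (wderiv D e_t u z * eta z) =
  \int[mu]_(x in J) (g x * kappa x) - \int[mu2]_(z in D) (u z * eta_t z).
Proof.
move=> [Lu du _] [Lg [phi [[sphi phiu dphiu _] phig]]] C1eta ck bdry.
have [ceta cetat _ _ _] := C1eta.
have C1phi n := smooth_C1 (sphi n).
have L2phi n : L2 mu2 D (phi n) by apply: continuous_L2; case: (C1phi n).
have L2dphi n : L2 mu2 D ('D_e_t (phi n)) by apply: continuous_L2; case: (C1phi n).
have L2phis n : L2 mu J (fun x => phi n (s, x)).
  apply: multiplier_L2 => //; first exact: mu_itv_lty.
  by apply: continuous_itv_multiplier; apply: slice_x_continuous; case: (C1phi n).
(* For each smooth [phi n] the formula is the fundamental theorem of calculus in [t]. Its three
   integrals converge separately, and uniqueness of limits carries it over to [u]. *)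
have lim1 := cvg_mul L2dphi (wderiv_L2 du) dphiu ceta.
have lim2 := cvg_mul L2phi Lu phiu cetat.
have lim3 := @cvg_Rintegral_mul _ _ _ mu J mJ (mu_itv_lty c d) _ _ _ L2phis Lg phig
  (continuous_itv_multiplier c d ck).
apply: (cvg_unique (@Rhausdorff R) lim1); apply: cvg_trans (cvgB lim3 lim2).
apply: near_eq_cvg; near=> n; rewrite /=.
have /= := Rintegral_dt (C1M (C1phi n) C1eta).
rewrite RintegralD//; [|exact: L2_mul (L2phi n) cetat|exact: L2_mul (L2dphi n) ceta].
under [X in _ = X -> _]eq_Rintegral do rewrite bdry.
by move=> E; apply: etrans (congr1 (fun r => r - _) (esym E)) _; rewrite addrC addKr.
Unshelve. all: by end_near. Qed.

(** The weight vanishes on both sides [x = c] and [x = d], so every [phi n] loses its boundary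
    terms. Only the [H1] approximation matters, hence the sequence coming from a trace at a fixed
    time can serve here. *)
Lemma wderiv_x_by_parts (phi : nat -> R * R -> R) (u eta eta_t eta_x : R * R -> R) :
  H1_2 D u -> H1_approx D phi u -> C1 eta eta_t eta_x ->
  (forall t, I t -> eta (t, c) = 0) -> (forall t, I t -> eta (t, d) = 0) ->
  \int[mu2]_(z in D) (wderiv D e_x u z * eta z) =
  - \int[mu2]_(z in D) (u z * eta_x z).
Proof.
move=> [Lu _ du] [sphi phiu _ dphiu] C1eta etac etad.
have [ceta _ cetax _ _] := C1eta.
have C1phi n := smooth_C1 (sphi n).
have L2phi n : L2 mu2 D (phi n) by apply: continuous_L2; case: (C1phi n).
have L2dphi n : L2 mu2 D ('D_e_x (phi n)) by apply: continuous_L2; case: (C1phi n).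
have lim1 := cvg_mul L2dphi (wderiv_L2 du) dphiu ceta.
have lim2 := cvg_mul L2phi Lu phiu cetax.
apply: (cvg_unique (@Rhausdorff R) lim1); apply: cvg_trans (cvgN lim2).
apply: near_eq_cvg; near=> n; rewrite /=.
have /= := Rintegral_dx (C1M (C1phi n) C1eta).
rewrite RintegralD//; [|exact: L2_mul (L2phi n) cetax|exact: L2_mul (L2dphi n) ceta].
rewrite (@eq_Rintegral _ _ _ mu I (cst 0)); last first.
  by move=> t /set_mem It /=; rewrite etac// etad// !mulr0 subrr.
rewrite Rintegral_cst// mul0r => /eqP; rewrite addrC addr_eq0 => /eqP ->.
by [].
Unshelve. all: by end_near. Qed.

End rectangle.
End C1.

(** * A bump function *)

Section bump.
Context {R : realType}.
Implicit Types x y t k m : R.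

Lemma is_derive_affine (k m x : R) : is_derive x (1 : R) (fun x => k * x + m) k.
Proof.
have h := is_deriveD (is_deriveM (is_derive_cst k x 1) (is_derive_id x 1))
  (is_derive_cst m x 1).
apply: (@is_derive_eq R R R _ _ _ _ _ h _).
by rewrite /GRing.scale/= mulr1 mulr0 !addr0.
Qed.

Lemma is_derive_comp_affine (F f : R -> R) (k m : R) :
  (forall y : R, is_derive y (1 : R) F (f y)) ->
  forall x : R, is_derive x (1 : R) (fun x => F (k * x + m)) (k * f (k * x + m)).
Proof.
move=> dF x.
by apply: (@is_derive_eq R R R _ _ _ _ _ (@is_derive1_comp R F (fun x => k * x + m) x _ _ (dF _) (is_derive_affine k m x)) _); rewrite mulrC.
Qed.

Definition pospart (y : R) : R := Num.max y 0.

Lemma pospart_cases (y : R) :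
  pospart y = y /\ 0 <= y \/ pospart y = 0 /\ y <= 0.
Proof. by rewrite /pospart; case: (leP y 0) => ?; [right|left; split => //; exact: ltW]. Qed.

Lemma pospart_continuous : continuous pospart.
Proof.
move=> y; rewrite (_ : pospart = fun y => (y + `|y|) / 2).
  by apply: cvgMl; apply: cvgD; [exact: cvg_id|apply: cvg_norm; exact: cvg_id].
apply/funext => z; rewrite /pospart maxr_absE subr0 addr0; by [].
Qed.

(* The Taylor remainder of [pospart ^ 2] is at most [h ^ 2], at every point. *)
Lemma is_derive_pospart2 y :
  is_derive y (1 : R) (fun y => pospart y ^+ 2) (2 * pospart y).
Proof.
have lim : (fun h => h^-1 *: (((fun y => pospart y ^+ 2) \o shift y) (h *: (1 : R))
      - pospart y ^+ 2)) @ 0^' --> 2 * pospart y.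
  apply/cvgrPdist_lt => e e0; near=> h => /=.
  have h0 : h != 0 by near: h; exact: nbhs_dnbhs_neq.
  have he : `|h| < e by near: h; apply: dnbhs0_lt.
  apply: le_lt_trans he.
  rewrite /GRing.scale/= mulr1 (_ : _ - _ = h^-1 *
    (2 * pospart y * h - (pospart (h + y) ^+ 2 - pospart y ^+ 2))); last by field.
  rewrite normrM normfV ler_pdivrMl ?normr_gt0// -expr2 real_normK ?num_real//.
  rewrite ler_norml; case: (pospart_cases y) (pospart_cases (h + y)) => -[-> ?] [] [-> ?];
    by apply/andP; split; nra.
by split; [apply/cvg_ex; exists (2 * pospart y)|exact: cvg_lim lim].
Unshelve. all: by end_near. Qed.

(** The cube of the positive part equals its square times [y], also for [y <= 0] where both vanish,
    so the product rule reduces the claim to the square. *)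
Lemma is_derive_pospart3 y :
  is_derive y (1 : R) (fun y => pospart y ^+ 3) (3 * pospart y ^+ 2).
Proof.
have -> : (fun y : R => pospart y ^+ 3) = (fun y => pospart y ^+ 2) * id.
  apply/funext => z /=; rewrite exprS [in RHS]/GRing.mul/= mulrC /pospart.
  by case: (leP z 0) => // _; rewrite expr0n/= !mul0r.
apply: (@is_derive_eq R R R _ _ _ _ _ (is_deriveM (is_derive_pospart2 y) (is_derive_id y 1)) _).
rewrite /GRing.scale/= mulr1 /pospart.
by case: (leP y 0) => _; ring.
Qed.

Lemma exists_bump (t0 t1 : R) : t0 < t1 -> exists b b1 b2 : R -> R,
  [/\ [/\ continuous b, continuous b1 & continuous b2],
      forall t, is_derive t (1 : R) b (b1 t),
      forall t, is_derive t (1 : R) b1 (b2 t),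
      forall t, t <= t0 \/ t1 <= t -> b t = 0 /\ b1 t = 0
    & (forall t, 0 <= b t) /\ forall t, t0 < t < t1 -> 0 < b t].
Proof.
move=> t01.
pose g k m n t := pospart (k * t + m) ^+ n.
have cg k m n : continuous (g k m n).
  move=> t; apply: (@continuous_comp _ _ _ (fun t => pospart (k * t + m)) (fun u => u ^+ n)).
    apply: (@continuous_comp _ _ _ (fun t => k * t + m) pospart); last exact: pospart_continuous.
    by apply: cvgD; [apply: cvgMr; exact: cvg_id|exact: cvg_cst].
  exact: exprn_continuous.
have dg k m n F : (forall y : R, is_derive y (1 : R) (fun y => pospart y ^+ n) (F y)) ->
    forall t, is_derive t (1 : R) (g k m n) (k * F (k * t + m)).
  by move=> dF t; exact: (is_derive_comp_affine k m dF).
(* [l n] and [r n] are the n-th powers of the positive parts of [t - t0] and [t1 - t]. The bump is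
   [l 3 * r 3]: cubes are the lowest powers with a continuous second derivative. *)
pose l := g 1 (- t0); pose r := g (-1) t1.
have dl3 t : is_derive t (1 : R) (l 3) (3 * l 2 t).
  by have := dg 1 (- t0) _ _ is_derive_pospart3 t; rewrite mul1r.
have dl2 t : is_derive t (1 : R) (l 2) (2 * l 1%N t).
  by have := dg 1 (- t0) _ _ is_derive_pospart2 t; rewrite mul1r.
have dr3 t : is_derive t (1 : R) (r 3) (- (3 * r 2 t)).
  by have := dg (-1) t1 _ _ is_derive_pospart3 t; rewrite mulN1r.
have dr2 t : is_derive t (1 : R) (r 2) (- (2 * r 1%N t)).
  by have := dg (-1) t1 _ _ is_derive_pospart2 t; rewrite mulN1r.
exists (fun t => l 3 t * r 3 t).
exists (fun t => 3 * (l 2 t * r 3 t - l 3 t * r 2 t)).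
exists (fun t => 6 * (l 1%N t * r 3 t - 3 * (l 2 t * r 2 t) + l 3 t * r 1%N t)).
split.
- split=> t; repeat first [exact: cg|exact: cvg_cst|apply: cvgMr|apply: cvgM|apply: cvgB|apply: cvgD].
- move=> t; apply: (@is_derive_eq R R R _ _ _ _ _ (is_deriveM (dl3 t) (dr3 t)) _).
  by rewrite /GRing.scale/=; ring.
- move=> t.
  apply: (@is_derive_eq R R R _ _ _ _ _ (is_deriveM (is_derive_cst (3 : R) t 1)
    (is_deriveB (is_deriveM (dl2 t) (dr3 t)) (is_deriveM (dl3 t) (dr2 t)))) _).
  by rewrite /GRing.scale/=; ring.
- move=> t [tt|tt].
    have l0 n : l n.+1 t = 0 by rewrite /l /g /pospart max_r ?expr0n//; lra.
    by rewrite !l0 !mul0r subrr mulr0.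
  have r0 n : r n.+1 t = 0 by rewrite /r /g /pospart max_r ?expr0n//; lra.
  by rewrite !r0 !mulr0 subrr mulr0.
- split => t.
    by rewrite mulr_ge0// exprn_ge0// le_max lexx orbT.
  by move=> tt; rewrite mulr_gt0// exprn_gt0// lt_max; apply/orP; left; lra.
Qed.

End bump.

(** * Orthogonality to the force and to the equations *)

Section fst.
Context {R : realType}.
Local Notation mu := (@lebesgue_measure R).
Local Notation mu2 := (@lebesgue_measure R \x @lebesgue_measure R)%E.
Variables (I J : set R).
Hypotheses (mI : measurable I) (mJ : measurable J).

Lemma measurable_fun_comp_fst (w : R -> R) :
  measurable_fun I w -> measurable_fun (I `*` J) (fun z : R * R => w z.1).
Proof.
move=> mw _ Y mY.
rewrite (_ : _ `&` _ = (I `&` w @^-1` Y) `*` J).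
  by apply: measurableX => //; exact: mw.
by apply/seteqP; split => [[t x] /= [[? ?] ?]|[t x] /= [[? ?] ?]].
Qed.

(** By Tonelli the squared norm is just multiplied by [mu J]. This lets the derivative of a control,
    a function of time, be treated as an [L2] function of [(t, x)]. *)
Lemma L2_comp_fst (w : R -> R) : (mu J < +oo)%E ->
  L2 mu I w -> L2 mu2 (I `*` J) (fun z : R * R => w z.1).
Proof.
move=> fJ [mw iw]; split; first exact: measurable_fun_comp_fst.
have mw2 : measurable_fun (I `*` J) (fun z : R * R => (w z.1 ^+ 2)%:E).
  apply/measurable_EFinP.
  by apply: (measurable_fun_comp_fst (w := fun t => w t ^+ 2)); exact: measurable_funX.
have mIJ : measurable (I `*` J) by exact: measurableX.
apply/integrableP; split => //=.
under eq_integral do rewrite ger0_norm ?sqr_ge0//.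
rewrite integral_mkcond fubini_tonelli1//=; last 2 first.
- exact/(measurable_restrictT _ _).1.
- by move=> z; rewrite /patch; case: ifPn => // _; rewrite lee_fin sqr_ge0.
rewrite (_ : (fun t => _) =
    (fun t => mu J * (w t ^+ 2)%:E)%E \_ I); last first.
  apply/funext => t; rewrite /fubini_F /patch; case: ifPn => It.
    rewrite muleC -integral_cst// [RHS]integral_mkcond.
    by apply: eq_integral => x _; rewrite /patch in_setX/= It.
  by rewrite integral0_eq// => x _; rewrite in_setX/= (negbTE It).
rewrite -integral_mkcond.
have fw : (\int[mu]_(t in I) (w t ^+ 2)%:E < +oo)%E.
  case/integrableP : iw => _; under eq_integral do rewrite gee0_abs ?lee_fin ?sqr_ge0//.
  by [].
rewrite ge0_integralZl//; last 2 first.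
- by apply/measurable_EFinP; exact: measurable_funX.
- by move=> t _; rewrite lee_fin sqr_ge0.
by rewrite lte_mul_pinfty// ge0_fin_numE.
Qed.

End fst.

Section orthogonality.
Context {R : realType}.
Local Notation mu := (@lebesgue_measure R).
Local Notation mu2 := (@lebesgue_measure R \x @lebesgue_measure R)%E.
Variables (N : nat) (T : R).
Local Notation D := (Omega T).

Let mT : measurable (I_T T). Proof. exact: measurable_itv. Qed.
Let mL : measurable (@I_L R). Proof. exact: measurable_itv. Qed.
Let mD : measurable D. Proof. exact: measurableX. Qed.
Let fD : (mu2 D < +oo)%E. Proof. exact: mu2_rect_lty. Qed.

Lemma cell_multiplier (k : int) : multiplier D (fun z : R * R => \1_(cell N k) z.2 : R).
Proof.
rewrite (_ : (fun z => _) = \1_(setT `*` cell N k)).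
  by apply: indic_multiplier; apply: measurableX => //; exact: measurable_itv.
by apply/funext => z; rewrite !indicE in_setX in_setT.
Qed.

(** On each cell the force depends on [t] alone, so integrating in [x] first leaves the vanishing
    cell integral of [eta] as a factor. Measurability and integrability are carried along because
    the induction over the cells splits the integral of a sum. *)
Lemma force_orthogonal (u : int -> R -> R) (eta : R * R -> R) :
  (forall k, k \in Js N -> H1 (I_T T) (u k)) ->
  continuous eta ->
  (forall k t, k \in Js N -> I_T T t ->
     (\int[mu]_(x in I_L) (\1_(cell N k) x * eta (t, x))%:E = 0)%E) ->
  [/\ measurable_fun D (force N T u),
      mu2.-integrable D (EFin \o (fun z => force N T u z * eta z))
    & \int[mu2]_(z in D) (force N T u z * eta z) = 0].
Proof.
move=> Hu ceta eta0; rewrite /force.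
have meta : multiplier D eta by exact: continuous_rect_multiplier.
elim: (Js N) Hu eta0 => [_ _|k s IH Hu eta0].
  split.
  - by under eq_fun do rewrite big_nil; exact: measurable_cst.
  - rewrite (_ : _ \o _ = cst 0%E); first exact: integrable0.
    by apply/funext => z /=; rewrite big_nil mul0r.
  - rewrite (@eq_Rintegral _ _ _ mu2 D (cst 0)) ?Rintegral_cst ?mul0r// => z _.
    by rewrite big_nil mul0r.
have [||ms ints s0] := IH.
- by move=> j js; apply: Hu; rewrite inE js orbT.
- by move=> j t js; apply: eta0; rewrite inE js orbT.
pose w := wderiv1 (I_T T) (u k).
have L2w : L2 mu (I_T T) w.
  have [_ [w' ew']] := Hu k (mem_head _ _).
  by have [] := xgetPex (fun=> 0) (ex_intro [set w | weak_deriv1 (I_T T) (u k) w] w' ew').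
have L2wD : L2 mu2 D (fun z => w z.1).
  by apply: L2_comp_fst => //; exact: mu_itv_lty.
have ik : mu2.-integrable D (EFin \o (fun z => w z.1 * (\1_(cell N k) z.2 * eta z))).
  by apply: L2_mul_integrable => //; apply: multiplierM => //; exact: cell_multiplier.
have E z : (\sum_(j <- k :: s) wderiv1 (I_T T) (u j) z.1 * \1_(cell N j) z.2) * eta z =
    w z.1 * (\1_(cell N k) z.2 * eta z) +
    (\sum_(j <- s) wderiv1 (I_T T) (u j) z.1 * \1_(cell N j) z.2) * eta z.
  by rewrite big_cons mulrDl mulrA.
split.
- under eq_fun do rewrite big_cons; apply: measurable_funD => //.
  apply: measurable_funM; first by case: L2wD.
  by case: (cell_multiplier k).
- by under eq_fun do rewrite E; exact: integrable_EFinD.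
- under eq_Rintegral do rewrite E.
  rewrite RintegralD// s0 addr0.
  apply: etrans (@Rintegral_iterated_xt _ _ _ _ (cst 0) (measurable_itv _) (measurable_itv _) ik _) _;
    last by rewrite Rintegral_cst ?mul0r//; exact: measurable_itv.
  move=> t It; rewrite /=.
  under eq_integral do rewrite EFinM.
  have ice : mu.-integrable I_L (EFin \o (fun x => \1_(cell N k) x * eta (t, x))).
    apply: multiplier_integrable => //; first exact: mu_itv_lty.
    apply: multiplierM => //; last by apply: continuous_itv_multiplier; exact: slice_x_continuous.
    by apply: indic_multiplier; exact: measurable_itv.
  by rewrite integralZl// eta0 ?mem_head// mule0.
Qed.

Let L2_mul w eta : L2 mu2 D w -> continuous eta ->
  mu2.-integrable D (EFin \o (fun z => w z * eta z)).
Proof. by move=> Lw ceta; apply: L2_mul_integrable => //; exact: continuous_rect_multiplier. Qed.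

(** A nonnegative integrand with zero integral vanishes almost everywhere, hence so do both squares:
    [v_t = r_x] and [v_x = r_t - f]. Testing the second equation against [eta2] removes the
    force. *)
Lemma Q_orthogonal (v r : R * R -> R) (u : int -> R -> R) (eta1 eta2 : R * R -> R) :
  H1_2 D v -> H1_2 D r -> Q N T v r u = 0%E ->
  measurable_fun D (force N T u) -> 
  mu2.-integrable D (EFin \o (fun z => force N T u z * eta2 z)) ->
  \int[mu2]_(z in D) (force N T u z * eta2 z) = 0 ->
  continuous eta1 -> continuous eta2 ->
  \int[mu2]_(z in D) (wderiv D e_t v z * eta1 z) =
    \int[mu2]_(z in D) (wderiv D e_x r z * eta1 z) /\
  \int[mu2]_(z in D) (wderiv D e_x v z * eta2 z) =
    \int[mu2]_(z in D) (wderiv D e_t r z * eta2 z).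
Proof.
move=> [_ vt vx] [_ rt rx] Q0 mf if2 f20 ceta1 ceta2.
have := (wderiv_L2 vt, wderiv_L2 vx, wderiv_L2 rt, wderiv_L2 rx).
set vt' := wderiv D e_t v; set vx' := wderiv D e_x v.
set rt' := wderiv D e_t r; set rx' := wderiv D e_x r.
move=> [[[Lvt Lvx] Lrt] Lrx].
have mq : measurable_fun D (q N T v r u).
  apply: measurable_funD; apply: measurable_funM => //; apply: measurable_funX;
    apply: measurable_funB; [by case: Lvt|by case: Lrx|by case: Lvx|].
  by apply: measurable_funB; [case: Lrt|].
have q0 : ae_eq mu2 D (EFin \o q N T v r u) (cst 0%E).
  apply/ae_eq_integral_abs => //; first exact/measurable_EFinP.
  rewrite -[RHS]Q0; apply: eq_integral => z _ /=.
  by rewrite ger0_norm// addr_ge0// mulr_ge0// sqr_ge0.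
have q00 z : q N T v r u z = 0 ->
    vt' z = rx' z /\ vx' z = rt' z - force N T u z.
  rewrite /q -/vt' -/vx' -/rt' -/rx'.
  have := sqr_ge0 (vt' z - rx' z); have := sqr_ge0 (vx' z - (rt' z - force N T u z)).
  move: (vt' z) (vx' z) (rt' z) (rx' z) (force N T u z) => a b c d e ? ? ?.
  have /eqP : (a - d) ^+ 2 = 0 by lra.
  have /eqP : (b - (c - e)) ^+ 2 = 0 by lra.
  by rewrite !expf_eq0/= !subr_eq0 => /eqP -> /eqP ->.
have ivt := L2_mul Lvt ceta1; have irx := L2_mul Lrx ceta1.
have ivx := L2_mul Lvx ceta2; have irt := L2_mul Lrt ceta2.
split.
  apply: (@ae_eq_Rintegral _ _ _ mu2 D mD _ _ ivt irx).
  by apply: filterS q0 => z qz Dz; have [-> _] := q00 z (EFin_inj (qz Dz)).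
(* The force integral, being zero, is subtracted on the right to make the integrand
   [(r_t - f) * eta2]. *)
rewrite -[RHS]subr0 -f20 -RintegralB//.
apply: (@ae_eq_Rintegral _ _ _ mu2 D mD _ _ ivx).
  rewrite (_ : _ \o _ = fun z => (rt' z * eta2 z)%:E - (force N T u z * eta2 z)%:E)%E//.
  exact: integrableB.
by apply: filterS q0 => z qz Dz; have [_ ->] := q00 z (EFin_inj (qz Dz)); rewrite mulrBl.
Qed.
End orthogonality.

(** * The conserved quantity *)

Section duality.
Context {R : realType}.
Local Notation mu := (@lebesgue_measure R).
Local Notation mu2 := (@lebesgue_measure R \x @lebesgue_measure R)%E.
Variables (N : nat) (T : R).
Hypothesis T0 : 0 < T.
Local Notation D := (Omega T).

Let mL : measurable (@I_L R). Proof. exact: measurable_itv. Qed.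
Let mT : measurable (I_T T). Proof. exact: measurable_itv. Qed.
Let mD : measurable D. Proof. exact: measurableX. Qed.
Let fD : (mu2 D < +oo)%E. Proof. exact: mu2_rect_lty. Qed.
Let T0' : 0 <= T. Proof. exact: ltW. Qed.
Let le11 : (-1 : R) <= 1. Proof. by lra. Qed.

Let L2_mul w eta : L2 mu2 D w -> continuous eta ->
  mu2.-integrable D (EFin \o (fun z => w z * eta z)).
Proof. by move=> Lw ceta; apply: L2_mul_integrable => //; exact: continuous_rect_multiplier. Qed.

Lemma C1_affine_t (k l : R) :
  C1 (fun z : R * R => k * z.1 + l) (fun=> k) (fun=> 0).
Proof.
split.
- move=> z; apply: cvgD; last exact: cvg_cst.
  by apply: cvgMr; exact: cvg_fst.
- by move=> z; exact: cvg_cst.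
- by move=> z; exact: cvg_cst.
- move=> t x; exact: is_derive_affine.
- by move=> t x; exact: (is_derive_cst (k * t + l) x 1).
Qed.

Variables (p s a b : R * R -> R).
Hypotheses (C1p : C1 p a b) (C1s : C1 s b a).
Hypothesis p0 : forall t, I_T T t -> p (t, -1) = 0 /\ p (t, 1) = 0.
Hypothesis s0 : forall t, I_T T t -> s (t, -1) = 0 /\ s (t, 1) = 0.
Hypothesis cell0 : forall k t, k \in Js N -> I_T T t ->
  (\int[mu]_(x in I_L) (\1_(cell N k) x * s (t, x))%:E = 0)%E.

(* Pairing the equations with [(chi p, chi s)], [chi] affine in time, moves
   all derivatives onto [chi]. *)
Lemma weighted_balance (v r : R * R -> R) (u : int -> R -> R) (gv gr : R -> R)
    (k l sg t0 : R) :
  H1_2 D v -> H1_2 D r -> (forall j, j \in Js N -> H1 (I_T T) (u j)) ->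
  Q N T v r u = 0%E ->
  trace_t (I_T T) I_L t0 v gv -> trace_t (I_T T) I_L t0 r gr ->
  (forall f : R -> R, f T * (k * T + l) - f 0 * (k * 0 + l) = f t0 * sg) ->
  sg * (\int[mu]_(x in I_L) (gv x * p (t0, x)) +
        \int[mu]_(x in I_L) (gr x * s (t0, x))) =
  k * (\int[mu2]_(z in D) (v z * p z) + \int[mu2]_(z in D) (r z * s z)).
Proof.
(* [A1], [A2] are the integrals at time [t0]; [W1], [W2] those of [v * p] and [r * s] over the
   domain. [V] and [Z] are the integrals of [v * a * chi] and [r * b * chi]: because [p_t = s_x = a]
   and [s_t = p_x = b], each arises once from a time derivative and once from a space derivative,
   and cancels. *)
have alg (A1 A2 W1 W2 V Z : R) : sg * A1 - (k * W1 + V) = - Z ->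
    - V = sg * A2 - (k * W2 + Z) -> sg * (A1 + A2) = k * (W1 + W2).
  by lra.
move=> Hv Hr Hu Q0 trv trr bdry.
pose chi (z : R * R) : R := k * z.1 + l.
have C1chi : C1 chi (fun=> k) (fun=> 0) := C1_affine_t k l.
have C1pc := C1M C1p C1chi; have C1sc := C1M C1s C1chi.
have [cp ca cb _ _] := C1p; have [cs _ _ _ _] := C1s; have [cchi _ _ _ _] := C1chi.
have [cpc _ _ _ _] := C1pc; have [csc _ _ _ _] := C1sc.
have [mf if_ f0] : [/\ measurable_fun D (force N T u),
      mu2.-integrable D (EFin \o (fun z => force N T u z * (s z * chi z)))
    & \int[mu2]_(z in D) (force N T u z * (s z * chi z)) = 0].
  (* The factor [chi] depends on time only, so [s * chi] still has integral zero over every cell. *)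
  apply: force_orthogonal => // j t js It.
  under eq_integral => x _ do rewrite (mulrA _ (s (t, x)) (k * t + l)) EFinM.
  rewrite integralZr//; first by rewrite cell0// mul0e.
  apply: multiplier_integrable => //; first exact: mu_itv_lty.
  apply: multiplierM => //; last by apply: continuous_itv_multiplier; exact: slice_x_continuous.
  by apply: indic_multiplier; exact: measurable_itv.
have [E1 E2] := Q_orthogonal Hv Hr Q0 mf if_ f0 cpc csc.
have [Lv _ _] := Hv; have [Lr _ _] := Hr.
have split_int (w f g : R * R -> R) : L2 mu2 D w -> continuous f -> continuous g ->
   \int[mu2]_(z in D) (w z * (f z * k + g z * chi z)) =
   k * \int[mu2]_(z in D) (w z * f z) + \int[mu2]_(z in D) (w z * (g z * chi z)).
  move=> Lw cf cg; have iwf := L2_mul Lw cf.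
  have cgc : continuous (fun z => g z * chi z).
    by move=> z; apply: cvgM; [exact: cg|exact: cchi].
  have iwg := L2_mul Lw cgc.
  rewrite -(@RintegralZl _ _ _ mu2 D _ k mD iwf).
  rewrite -(@RintegralD _ _ _ mu2 D _ _ mD (@integrable_EFinZl _ _ _ mu2 D mD k _ iwf) iwg).
  by apply: eq_Rintegral => z _; ring.
have by_parts_t w g f ft fx : H1_2 D w -> trace_t (I_T T) I_L t0 w g -> C1 f ft fx ->
    \int[mu2]_(z in D) (wderiv D e_t w z * (f z * chi z)) =
    sg * \int[mu]_(x in I_L) (g x * f (t0, x)) -
    (k * \int[mu2]_(z in D) (w z * f z) + \int[mu2]_(z in D) (w z * (ft z * chi z))).
  move=> Hw trw C1f; have [cf cft _ _ _] := C1f; have [Lw _ _] := Hw.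
  have cfx : continuous (fun x => f (t0, x)) by exact: slice_x_continuous.
  have [Lg _] := trw.
  have ig := @L2_mul_integrable _ _ _ mu I_L mL (mu_itv_lty _ _) _ _ Lg
    (continuous_itv_multiplier _ _ cfx).
  rewrite -(split_int _ _ _ Lw cf cft) -(@RintegralZl _ _ _ mu I_L _ sg mL ig).
  rewrite (@eq_Rintegral _ _ _ mu I_L (fun x => g x * (f (t0, x) * sg))); last first.
    by move=> x _; rewrite mulrC mulrA.
  apply: (trace_t_by_parts T0' Hw trw (C1M C1f C1chi)).
    by move=> x; apply: cvgMl; exact: cfx.
  by move=> h x; rewrite !mulrA -(bdry (fun t => h (t, x) * f (t, x))).
have by_parts_x w g f ft fx : H1_2 D w -> trace_t (I_T T) I_L t0 w g -> C1 f ft fx ->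
    (forall t, I_T T t -> f (t, -1) = 0 /\ f (t, 1) = 0) ->
    \int[mu2]_(z in D) (wderiv D e_x w z * (f z * chi z)) =
    - \int[mu2]_(z in D) (w z * (fx z * chi z)).
  move=> Hw [_ [phi [phiw _]]] C1f f0'.
  have left t : I_T T t -> f (t, -1) * chi (t, -1) = 0.
    by move=> It; rewrite (f0' t It).1 mul0r.
  have right t : I_T T t -> f (t, 1) * chi (t, 1) = 0.
    by move=> It; rewrite (f0' t It).2 mul0r.
  apply: etrans (wderiv_x_by_parts le11 Hw phiw (C1M C1f C1chi) left right) _.
  by congr (- _); apply: eq_Rintegral => z _; rewrite mulr0 add0r.
have E3 := by_parts_t _ _ _ _ _ Hv trv C1p.
have E4 := by_parts_t _ _ _ _ _ Hr trr C1s.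
have E5 := by_parts_x _ _ _ _ _ Hv trv C1s s0.
have E6 := by_parts_x _ _ _ _ _ Hr trr C1p p0.
exact: alg (etrans (esym E3) (etrans E1 E6)) (etrans (esym E5) (etrans E2 E4)).
Qed.

(** The weights [t / T] for the final time and [1 - t / T] for the initial time each vanish at the
    opposite end. Their slopes are opposite, so the domain integrals cancel when the two balances
    are added. *)
Lemma conservation (v r : R * R -> R) (u : int -> R -> R) (v0 r0 v1 r1 : R -> R) :
  H1_2 D v -> H1_2 D r -> (forall j, j \in Js N -> H1 (I_T T) (u j)) ->
  Q N T v r u = 0%E ->
  trace_t (I_T T) I_L 0 v v0 -> trace_t (I_T T) I_L 0 r r0 ->
  trace_t (I_T T) I_L T v v1 -> trace_t (I_T T) I_L T r r1 ->
  \int[mu]_(x in I_L) (v1 x * p (T, x)) + \int[mu]_(x in I_L) (r1 x * s (T, x)) =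
  \int[mu]_(x in I_L) (v0 x * p (0, x)) + \int[mu]_(x in I_L) (r0 x * s (0, x)).
Proof.
move=> Hv Hr Hu Q0 tv0 tr0 tv1 tr1.
have Tn0 : T != 0 by rewrite gt_eqF.
have := @weighted_balance v r u v1 r1 T^-1 0 1 T Hv Hr Hu Q0 tv1 tr1.
have := @weighted_balance v r u v0 r0 (- T^-1) 1 (-1) 0 Hv Hr Hu Q0 tv0 tr0.
rewrite mulNr mulVf// => E0 E1.
have {}E0 := E0 ltac:(by move=> f; ring).
have {}E1 := E1 ltac:(by move=> f; ring).
by move: E0 E1; lra.
Qed.

End duality.

(** * Terminal data and positivity *)

Section data.
Context {R : realType}.
Local Notation mu := (@lebesgue_measure R).

Lemma C1_lin (k l : R) (f ft fx g gt gx : R * R -> R) :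
  C1 f ft fx -> C1 g gt gx ->
  C1 (fun z => k * f z + l * g z) (fun z => k * ft z + l * gt z)
     (fun z => k * fx z + l * gx z).
Proof.
move=> [cf cft cfx dft dfx] [cg cgt cgx dgt dgx]; split.
- by move=> z; apply: cvgD; apply: cvgMr; [exact: cf|exact: cg].
- by move=> z; apply: cvgD; apply: cvgMr; [exact: cft|exact: cgt].
- by move=> z; apply: cvgD; apply: cvgMr; [exact: cfx|exact: cgx].
- move=> t x; exact: (is_deriveD (is_deriveZ k (dft t x)) (is_deriveZ l (dgt t x))).
- move=> t x; exact: (is_deriveD (is_deriveZ k (dfx t x)) (is_deriveZ l (dgx t x))).
Qed.

(** The classical derivative serves as weak derivative: a test function is supported in the open
    interval, so it vanishes at both endpoints and integration by parts has no boundary term. *)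
Lemma C1_H1 (F f : R -> R) (a b : R) : a <= b ->
  continuous f -> (forall x : R, is_derive x (1 : R) F (f x)) -> H1 `]a, b[ F.
Proof.
move=> ab cf dF.
have cF : continuous F.
  by move=> x; apply/differentiable_continuous/derivable1_diffP; have [] := dF x.
have L2c g : continuous g -> L2 mu `]a, b[ g.
  by move=> cg; apply: multiplier_L2; [exact: measurable_itv|exact: mu_itv_lty|exact: continuous_itv_multiplier].
split; first exact: L2c.
exists f; split; first exact: L2c.
move=> phi [sphi [K [_ KI phi0]]].
have [cphi dphi'] := sphi 1%N.
have [dphi [cdphi _]] := dphi' 1.
have {}dphi x : is_derive x (1 : R) phi ('D_1 phi x) by split.
have phia : phi a = 0 by apply: phi0 => /KI; rewrite /= in_itv/= ltxx.
have phib : phi b = 0 by apply: phi0 => /KI; rewrite /= in_itv/= ltxx andbF.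
have mI : measurable (`]a, b[ : set R) by exact: measurable_itv.
have i1 := @L2_mul_integrable _ _ _ mu `]a, b[ mI (mu_itv_lty _ _) _ _ (L2c _ cF)
  (continuous_itv_multiplier _ _ cdphi).
have i2 := @L2_mul_integrable _ _ _ mu `]a, b[ mI (mu_itv_lty _ _) _ _ (L2c _ cf)
  (continuous_itv_multiplier _ _ cphi).
rewrite (@eq_Rintegral _ _ _ mu _ (fun x => F x * 'D_1 phi x)); last first.
  by move=> x _; rewrite derive1E.
apply/eqP; rewrite -addr_eq0 -(@RintegralD _ _ _ mu _ _ _ mI i1 i2); apply/eqP.
pose h x := F x * 'D_1 phi x + f x * phi x.
have ch : continuous h.
  by move=> x; apply: cvgD; apply: cvgM; [exact: cF|exact: cdphi|exact: cf|exact: cphi].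
have dh x : is_derive x (1 : R) (fun x => F x * phi x) (h x).
  apply: (@is_derive_eq R R R _ _ _ _ _ (is_deriveM (dF x) (dphi x)) _).
  by rewrite /GRing.scale/= [phi _ * _]mulrC.
by apply: etrans (congr1 fine (integral_derive_itvoo ab ch dh)) _; rewrite phia phib !mulr0 subrr.
Qed.

(** If the integral were zero, [f] would vanish outside a null set; but that set would have to
    contain []c, d[], which has positive length. *)
Lemma Rintegral_gt0_continuous (f : R -> R) (a b c d : R) :
  a <= c -> c < d -> d <= b -> continuous f -> (forall x, 0 <= f x) ->
  (forall x, c < x < d -> 0 < f x) -> \int[mu]_(x in `]a, b[) f x != 0.
Proof.
move=> ac cd db cf f0 fpos; apply/eqP => intf.
have mI : measurable (`]a, b[ : set R) by exact: measurable_itv.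
have if_ := @multiplier_integrable _ _ _ mu _ mI (mu_itv_lty a b) _ (continuous_itv_multiplier a b cf).
have : ae_eq mu `]a, b[%classic (EFin \o f) (cst 0%E).
  apply/ae_eq_integral_abs => //; first exact: measurable_int if_.
  transitivity (\int[mu]_(x in `]a, b[) (f x)%:E)%E.
    by apply: eq_integral => x _ /=; rewrite ger0_norm.
  by rewrite -[LHS]fineK ?integrable_fin_num// -/(Rintegral mu _ f) intf.
case=> A [mA A0 subA].
have : (mu `]c, d[%classic <= mu A)%E.
  apply: le_measure; rewrite ?inE//; apply: subset_trans subA => x /=.
  rewrite in_itv/= => /andP[cx xd] /=; move=> /(_ _)/=.
  rewrite in_itv/= (le_lt_trans ac)// (lt_le_trans xd)// => /(_ isT) [] fx0.
  by have := fpos x; rewrite cx xd fx0 ltxx => /(_ isT).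
rewrite [X in (_ <= X)%E]A0 lebesgue_measure_itv/= lte_fin cd -EFinD lee_fin.
by rewrite subr_le0 leNgt cd.
Qed.

End data.

(** * The adjoint state *)

Section wave.
Context {R : realType}.
Local Notation mu := (@lebesgue_measure R).

(** A profile travelling at unit speed, to the right for [e = 1] and to the left for [e = -1]; at
    [x = c] both waves take the value [h t]. *)
Definition wave (c e : R) (h : R -> R) (z : R * R) : R := h (z.1 + e * (c - z.2)).

Lemma wave_continuous (c e : R) (h : R -> R) : continuous h -> continuous (wave c e h).
Proof.
move=> ch z; apply: (@continuous_comp _ _ _ (fun z : R * R => z.1 + e * (c - z.2)) h);
  last exact: ch.
apply: cvgD; first exact: cvg_fst.
by apply: cvgMr; apply: cvgB; [exact: cvg_cst|exact: cvg_snd].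
Qed.

Lemma C1_wave (c e : R) (h h' : R -> R) : continuous h -> continuous h' ->
  (forall y : R, is_derive y (1 : R) h (h' y)) ->
  C1 (wave c e h) (wave c e h') (fun z => - e * wave c e h' z).
Proof.
move=> ch ch' dh; split; try exact: wave_continuous.
- by move=> z; apply: cvgMr; exact: wave_continuous.
- move=> t x; have := is_derive_comp_affine 1 (e * (c - x)) dh t; rewrite mul1r mul1r.
  by rewrite /wave/=; under eq_fun do rewrite mul1r.
- move=> t x; have := is_derive_comp_affine (- e) (t + e * c) dh x.
  have E y : - e * y + (t + e * c) = t + e * (c - y) by ring.
  by rewrite /wave/= E; under eq_fun do rewrite E.
Qed.

Variable N : nat.
Hypothesis N2 : (2 <= N)%N.
Local Notation lam := (lambda N : R).

Lemma mulr_lambda : N%:R * lam = 2.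
Proof. by rewrite /lambda mulrCA mulfV ?mulr1// pnatr_eq0 -lt0n (leq_trans _ N2). Qed.

Lemma lambda_gt0 : 0 < lam.
Proof. by rewrite /lambda divr_gt0// ltr0n (leq_trans _ N2). Qed.

Lemma lambda_le1 : lam <= 1.
Proof.
have := mulr_lambda; have : 2%:R <= N%:R :> R by rewrite ler_nat.
have := lambda_gt0; nra.
Qed.

Lemma node_even (j : nat) : node N (2 * j%:Z - N%:Z) = -1 + j%:R * lam.
Proof.
rewrite /node rmorphB rmorphM/= -!pmulrn -[(1 + 1)%:R]/(2 : R).
move: mulr_lambda; move: (N%:R) (j%:R) (lambda N) => n x l nl.
by rewrite (_ : _ / 2 = x * l - n * l / 2); [rewrite nl|]; field.
Qed.

(** Counting from the left end turns the parity-indexed cell boundaries into consecutive multiples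
    of the cell length. *)
Lemma Js_nodes (k : int) : k \in Js N -> exists i : nat, [/\ (i < N)%N,
  node N (k - 1) = -1 + i%:R * lam & node N (k + 1) = -1 + i.+1%:R * lam].
Proof.
move=> /mapP[i]; rewrite mem_iota add0n => /= iN ->; exists i.
by split => //; rewrite -node_even; congr node; rewrite ?intS; ring.
Qed.

Variable T : R.
Hypotheses (T0 : 0 < T) (T2 : T < 2 * lam).

Lemma adjoint_state : exists p s p_t s_t : R * R -> R,
  [/\ C1 p p_t s_t, C1 s s_t p_t,
      forall t, I_T T t -> [/\ p (t, -1) = 0, p (t, 1) = 0, s (t, -1) = 0 & s (t, 1) = 0],
      forall k t, k \in Js N -> I_T T t ->
        (\int[mu]_(x in I_L) (\1_(cell N k) x * s (t, x))%:E = 0)%E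
    & \int[mu]_(x in I_L) (x * p (T, x)) != 0].
Proof.
(* The last interior node. It lies at distance [lam] from the right end and, since [N >= 2] gives
   [lam <= 1], at distance [2 - lam >= lam] from the left end. *)
pose c : R := 1 - lam.
have lam0 := lambda_gt0; have lam1 := lambda_le1.
(* At time [T] the wave [b (T + c - x)] is positive exactly for [x] in []T + 1 - 2 * lam, 1[]; these
   two bounds say that this interval is nonempty and lies in the rod. *)
have pulse_lt : T + 1 - 2 * lam < 1 by move: T2; lra.
have pulse_ge : -1 <= T + 1 - 2 * lam by move: T0 lam1; lra.
have [b [b1 [b2 [[cb cb1 cb2] db db1 b0 [bge0 bgt0]]]]] :
  exists b b1 b2 : R -> R, [/\ [/\ continuous b, continuous b1 & continuous b2],
      forall t, is_derive t (1 : R) b (b1 t),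
      forall t, is_derive t (1 : R) b1 (b2 t),
      forall t, t <= T - lam \/ lam <= t -> b t = 0 /\ b1 t = 0
    & (forall t, 0 <= b t) /\ forall t, T - lam < t < lam -> 0 < b t].
  by apply: exists_bump; rewrite ltrBlDr -mulr2n -mulr_natl.
pose w := wave c.
(* A potential of the adjoint state: [P_t = p] and [P_x = s]. *)
pose P (z : R * R) : R := 1 * w 1 b z + (-1) * w (-1) b z.
pose p (z : R * R) : R := 1 * w 1 b1 z + (-1) * w (-1) b1 z.
pose s (z : R * R) : R := (-1) * w 1 b1 z + (-1) * w (-1) b1 z.
pose p_t (z : R * R) : R := 1 * w 1 b2 z + (-1) * w (-1) b2 z.
pose s_t (z : R * R) : R := (-1) * w 1 b2 z + (-1) * w (-1) b2 z.
have Wb e := C1_wave c e cb cb1 db.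
have Wb1 e := C1_wave c e cb1 cb2 db1.
have C1p : C1 p p_t s_t.
  have := C1_lin 1 (-1) (Wb1 1) (Wb1 (-1)).
  by congr C1; apply/funext => z; rewrite /s_t /w; ring.
have C1s : C1 s s_t p_t.
  have := C1_lin (-1) (-1) (Wb1 1) (Wb1 (-1)).
  by congr C1; apply/funext => z; rewrite /p_t /w; ring.
have C1P : C1 P p s.
  have := C1_lin 1 (-1) (Wb 1) (Wb (-1)).
  by congr C1; apply/funext => z; rewrite /s /w; ring.
(* For [0 <= t <= T], shifting [t] by at least [lam] leads out of []T - lam, lam[] in either
   direction, hence out of the support of [b]. *)
have far (t d : R) : 0 <= t <= T -> lam <= `|d| ->
    [/\ b (t + d) = 0, b1 (t + d) = 0, b (t - d) = 0 & b1 (t - d) = 0].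
  move=> /andP[t0 tT]; rewrite ler_normr => ld.
  have [-> ->] := b0 (t + d) ltac:(case/orP: ld => ?; [right|left]; lra).
  by have [-> ->] := b0 (t - d) ltac:(case/orP: ld => ?; [left|right]; lra).
have wE (e : R) h (t x : R) : w e h (t, x) = h (t + e * (c - x)) by [].
have side (t x : R) : 0 <= t <= T -> x = -1 \/ x = 1 -> lam <= `|c - x|.
  move=> _ [->|->]; rewrite ler_normr; apply/orP; [left|right]; rewrite /c; lra.
have ps0 (t x : R) : 0 <= t <= T -> x = -1 \/ x = 1 -> p (t, x) = 0 /\ s (t, x) = 0.
  move=> tT x1; have [_ h1 _ h2] := far t (c - x) tT (side t x tT x1).
  by rewrite /p /s !wE !mul1r !mulN1r h1 h2 !oppr0 addr0.
(* The nodes lie at integer multiples of [lam] from [c]. At [c] itself the two waves coincide and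
   cancel; at any other node both vanish by [far]. *)
have P0 (t : R) (i : nat) : 0 <= t <= T -> P (t, -1 + i%:R * lam) = 0.
  move=> tT; rewrite /P !wE !mul1r !mulN1r.
  set d := c - _.
  have [d0|dl] : d = 0 \/ lam <= `|d|.
    have dE : d = ((N - 1)%N%:R - i%:R) * lam.
      by rewrite natrB ?(ltnW N2)// /d /c; have := mulr_lambda; rewrite -/lam; lra.
    have [lt|lt|iN] := ltngtP i (N - 1)%N; last by left; rewrite dE iN subrr mul0r.
      right; rewrite dE -natrB ?(ltnW lt)// ger0_norm ?mulr_ge0 ?(ltW lam0)//.
      by rewrite ler_peMl ?ler1n ?subn_gt0// ltW.
    right; rewrite dE -normrN -mulNr opprB -natrB ?(ltnW lt)//.
    rewrite ger0_norm ?mulr_ge0 ?(ltW lam0)//.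
    by rewrite ler_peMl ?ler1n ?subn_gt0// ltW.
    by rewrite d0 oppr0 subrr.
  by have [-> _ -> _] := far t d tT dl; rewrite subrr.
have cell0 k t : k \in Js N -> I_T T t ->
    (\int[mu]_(x in I_L) (\1_(cell N k) x * s (t, x))%:E = 0)%E.
  move=> /Js_nodes[i [iN E1 E2]]; rewrite /I_T /= in_itv/= => /andP[t0 tT].
  have i1N : i.+1%:R * lam <= 2 by rewrite -mulr_lambda ler_pM2r// ler_nat.
  have ile : i%:R * lam <= i.+1%:R * lam by rewrite ler_pM2r// ler_nat.
  have ige : 0 <= i%:R * lam by rewrite mulr_ge0// ltW.
  have cellE : (cell N k : set R) = I_L `&` cell N k.
    apply/esym/setIidPr; rewrite /cell E1 E2 /I_L => x /=; rewrite !in_itv/= -/lam => /andP[? ?].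
    by apply/andP; split; lra.
  transitivity (\int[mu]_(x in cell N k) (s (t, x))%:E)%E.
    rewrite [in RHS]cellE integral_mkcondr; apply: eq_integral => x _.
    by rewrite patchE indicE; case: ifPn => _; rewrite ?mul1r ?mul0r.
  (* As [s = P_x], the cell integral is the difference of [P] between two consecutive nodes. *)
  have [_ _ cs _ dP] := C1P.
  rewrite /cell E1 E2 (@integral_derive_itvoo _ (fun x => P (t, x)))//.
  - by rewrite !P0 ?subrr// !ltW.
  - by rewrite -/lam; lra.
  - exact: slice_x_continuous.
exists p, s, p_t, s_t; split => //.
  move=> t; rewrite /I_T /= in_itv/= => /andP[t0 tT].
  have tT' : 0 <= t <= T by rewrite !ltW.
  by have [] := ps0 t _ tT' (or_introl erefl); have [] := ps0 t _ tT' (or_intror erefl).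
(* Since [g' = - p (T, x)] and [g] vanishes at both ends, integrating [(x * g)' = g - x * p (T, x)]
   shows that the integral of [x * p (T, x)] equals that of the nonnegative function [g]. *)
pose g x := 1 * w 1 b (T, x) + 1 * w (-1) b (T, x).
have TT : 0 <= T <= T by rewrite lexx ltW.
have g1 x : x = -1 \/ x = 1 -> g x = 0.
  move=> /(side T x TT) /(far T (c - x) TT)[h1 _ h2 _].
  by rewrite /g !wE !mul1r mulN1r h1 h2 addr0.
have [cg2 _ _ _ dg2] := C1_lin 1 1 (Wb 1) (Wb (-1)).
have cg : continuous g := slice_x_continuous (t := T) cg2.
have [cp0 _ _ _ _] := C1p.
have cp : continuous (fun x : R => p (T, x)) := slice_x_continuous (t := T) cp0.
have dg x : is_derive x (1 : R) g (- p (T, x)).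
  by apply: (@is_derive_eq R R R _ _ _ _ _ (dg2 T x) _); rewrite /p /w; ring.
have mI : measurable (@I_L R) by exact: measurable_itv.
have cxp : continuous (fun x : R => x * p (T, x)).
  by move=> x; apply: cvgM; [exact: cvg_id|exact: cp].
have ig := @multiplier_integrable _ _ _ mu _ mI (mu_itv_lty _ _) _
  (continuous_itv_multiplier (-1) 1 cg).
have ixp := @multiplier_integrable _ _ _ mu _ mI (mu_itv_lty _ _) _
  (continuous_itv_multiplier (-1) 1 cxp).
have chk : continuous (fun x : R => g x - x * p (T, x)).
  by move=> x; apply: cvgB; [exact: cg|exact: cxp].
have dxg x : is_derive x (1 : R) (fun x : R => x * g x) (g x - x * p (T, x)).
  apply: (@is_derive_eq R R R _ _ _ _ _ (is_deriveM (is_derive_id x 1) (dg x)) _).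
  by rewrite /GRing.scale/=; ring.
have le11 : (-1 : R) <= 1 by lra.
have : \int[mu]_(x in I_L) (g x - x * p (T, x)) = 0.
  apply: etrans (congr1 fine (integral_derive_itvoo le11 chk dxg)) _.
  by rewrite /= !g1; [ring|left|right].
rewrite (@RintegralB _ _ _ mu _ _ _ mI ig ixp) => /subr0_eq <-.
apply: (@Rintegral_gt0_continuous _ g _ _ (T + 1 - 2 * lam) 1) => //.
  by move=> x; rewrite /g !mul1r addr_ge0//; exact: bge0.
move=> x /andP[? ?]; rewrite /g !wE !mul1r; apply: ltr_wpDr; first exact: bge0.
by apply: bgt0; apply/andP; split; rewrite /c; lra.
Qed.

End wave.

(** * Data incompatible with the conserved quantity *)

Theorem theorem2 (R : realType) (N : nat) (hN : (2 <= N)%N)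
    (T : R) (hT0 : 0 < T) (hT : T < 2 * lambda N) :
  exists v0 r0 v1 r1 : R -> R,
    [/\ H1 I_L v0, H1 I_L r0, H1 I_L v1 & H1 I_L r1] /\
    ~ (exists (v r : R * R -> R) (u : int -> R -> R),
         solves_BVP N T v0 r0 v1 r1 v r u).
Proof.
have le11 : (-1 : R) <= 1 by lra.
have H0 : @H1 R I_L (fun=> 0).
  by apply: (@C1_H1 _ _ (fun=> 0)) => // x; exact: cvg_cst.
have Hid : @H1 R I_L id.
  by apply: (@C1_H1 _ _ (fun=> 1)) => // x; exact: cvg_cst.
(* With these data every term of the conservation law is zero except the pairing of [id] with
   [p (T, x)], which [adjoint_state] makes nonzero. *)
exists (fun=> 0), (fun=> 0), id, (fun=> 0); split; first by split.
move=> [v [r [u [[Hv Hr [_ Hu _ _]] Q0 [tv0 tr0 tv1 tr1] _ _]]]].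
have [p [s [p_t [s_t [C1p C1s side cell0]]]]] := adjoint_state hN hT0 hT.
have p0 t : I_T T t -> p (t, -1) = 0 /\ p (t, 1) = 0 by move=> /side[].
have s0 t : I_T T t -> s (t, -1) = 0 /\ s (t, 1) = 0 by move=> /side[].
have HJs j : j \in Js N -> H1 (I_T T) (u j).
  by move=> js; have [|] := Hu j; rewrite // /Jc !inE js !orbT.
have := conservation hT0 C1p C1s p0 s0 cell0
  Hv Hr HJs Q0 tv0 tr0 tv1 tr1.
have int0 (f : R -> R) : \int[lebesgue_measure]_(x in I_L) (0 * f x) = 0.
  under eq_Rintegral do rewrite mul0r.
  by rewrite Rintegral_cst ?mul0r//; exact: measurable_itv.
by rewrite !int0 !addr0 => ->; rewrite eqxx.
Qed.
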